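(* Let $x$ be a semi-discrete BrLW surface with Gauss map $n$ a semi-discrete BiLW surface. At a point $(k,t)$ of the domain write $g=g(k,t)$, $g_{\pm1}=g(k\pm1,t)$, $\Delta g=g_1-g$, $\Delta g_{-1}=g-g_{-1}$, $\sigma=\sigma(k)$, $\sigma_{-1}=\sigma(k-1)$, $\tau=\tau(t)$, and $$\alpha_{-1}(s)=1+s|g_{-1}|^2,\quad \alpha(s)=1+s|g|^2,\quad \alpha_1(s)=1+s|g_1|^2.$$ (i) The condition for $\kappa^x_{-10}\cdot\kappa^x_{01}$ (equivalently, $\kappa^n_{-10}\cdot\kappa^n_{01}$) to be nonpositive -- that is, we have an FPS point with respect to the discrete direction -- is $$\begin{cases}\{|\Delta g_{-1}|^2(1+s)-\lambda\sigma_{-1}\alpha_{-1}(s)\alpha(s)\}\cdot\{|\Delta g|^2(1+s)-\lambda\sigma\alpha(s)\alpha_1(s)\}>0,\\ \{|\Delta g_{-1}|^2(1-s)+\lambda\sigma_{-1}\alpha_{-1}(s)\alpha(s)\}\cdot\{|\Delta g|^2(1-s)+\lambda\sigma\alpha(s)\alpha_1(s)\}<0,\end{cases}$$ or $$\begin{cases}\{|\Delta g_{-1}|^2(1+s)-\lambda\sigma_{-1}\alpha_{-1}(s)\alpha(s)\}\cdot\{|\Delta g|^2(1+s)-\lambda\sigma\alpha(s)\alpha_1(s)\}<0,\\ \{|\Delta g_{-1}|^2(1-s)+\lambda\sigma_{-1}\alpha_{-1}(s)\alpha(s)\}\cdot\{|\Delta g|^2(1-s)+\lambda\sigma\alpha(s)\alpha_1(s)\}>0.\end{cases}$$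 (ii) The condition for $\kappa^x\cdot\kappa^x_1$ (equivalently, $\kappa^n\cdot\kappa^n_1$) to be nonpositive -- that is, we have an FPS point with respect to the smooth direction -- is $$\begin{cases}\{|\partial g|^2(1+s)-\lambda\tau\alpha(s)^2\}\cdot\{|\partial g_1|^2(1+s)-\lambda\tau\alpha_1(s)^2\}>0,\\ \{|\partial g|^2(1-s)+\lambda\tau\alpha(s)^2\}\cdot\{|\partial g_1|^2(1-s)+\lambda\tau\alpha_1(s)^2\}<0,\end{cases}$$ or $$\begin{cases}\{|\partial g|^2(1+s)-\lambda\tau\alpha(s)^2\}\cdot\{|\partial g_1|^2(1+s)-\lambda\tau\alpha_1(s)^2\}<0,\\ \{|\partial g|^2(1-s)+\lambda\tau\alpha(s)^2\}\cdot\{|\partial g_1|^2(1-s)+\lambda\tau\alpha_1(s)^2\}>0.\end{cases}$$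
   Context: Semi-discrete maps are maps $y(k,t)$ on a subdomain of $\mathbb{Z}\times\mathbb{R}$; write $y=y(k,t)$, $y_1=y(k+1,t)$, $\partial y=\frac{dy}{dt}$, $\Delta y=y_1-y$. $\mathbb{R}^{3,1}=\{(z_1,z_2,z_3,z_0)\}$ has metric $z_1w_1+z_2w_2+z_3w_3-z_0w_0$ and its points are identified with $2\times2$ matrices by $(z_1,z_2,z_3,z_0)\mapsto\begin{pmatrix} z_0+z_3 & z_1-iz_2 \\ z_1+iz_2 & z_0-z_3 \end{pmatrix}$. $\mathbb{H}^3$ is the set of vectors of squared norm $-1$ (both sheets, $z_0>0$ and $z_0<0$) and $\mathbb{S}^{2,1}$ is the set of vectors of squared norm $1$. A semi-discrete holomorphic function is a map $g(k,t)\in\mathbb{C}$ with $\partial g$ and $\Delta g$ never zero and $\dfrac{\partial g\,\partial g_1}{(\Delta g)^2}=\dfrac{\tau(t)}{\sigma(k)}<0$ for a real-valued function $\tau$ of $t$ only and a real-valued function $\sigma$ of $k$ only. Weierstrass-type representation: let $g$ be semi-discrete holomorphic, $s\in\mathbb{R}$ a constant with $\mathcal{T}:=1+s g\overline g\neq0$, and $\lambda\in\mathbb{R}$ a non-zero constant with $1-\lambda\sigma\neq0$. Solve, for $E\in\mathrm{GL}_2\mathbb{C}$, $$E^{-1}\Delta E=\begin{pmatrix}0&\Delta g\\ \frac{\lambda\sigma}{\Delta g}&0\end{pmatrix},\qquad E^{-1}\partial E=\begin{pmatrix}0&\partial g\\ \frac{\lambda\tau}{\partial g}&0\end{pmatrix},$$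 let $L=\begin{pmatrix}0&\sqrt{\mathcal{T}}\\ \frac{-1}{\sqrt{\mathcal{T}}}&\frac{-s\overline g}{\sqrt{\mathcal{T}}}\end{pmatrix}$, and set $$x=\frac{\mathrm{sgn}(\mathcal{T})}{\det E}EL(\overline{EL})^t,\qquad n=\frac{\mathrm{sgn}(\mathcal{T})}{\det E}EL\begin{pmatrix}1&0\\0&-1\end{pmatrix}(\overline{EL})^t.$$ Then $x$ is a semi-discrete BrLW surface (linear Weingarten surface of Bryant type) in $\mathbb{H}^3$ and its unit normal $n$ is a semi-discrete BiLW surface (linear Weingarten surface of Bianchi type) in $\mathbb{S}^{2,1}$. Principal curvatures of $x$: the scalars with $\partial n=-\kappa^x\,\partial x$ at $(k,t)$ and $\Delta n=-\kappa^x_{01}\,\Delta x$ at the edge joining $(k,t)$ and $(k+1,t)$; $\kappa^x_1$ is the value of $\kappa^x$ at $(k+1,t)$, and $\kappa^x_{-10}$ is the principal curvature of the edge joining $(k-1,t)$ and $(k,t)$. The principal curvatures $\kappa^n,\kappa^n_1,\kappa^n_{01},\kappa^n_{-10}$ of $n$ are defined in the same way, regarding $x$ as the normal of $n$. FPS (flat, parabolic or singular) points: $(k,t)$ is an FPS point with respect to the discrete direction if $\kappa_{-10}\kappa_{01}<0$ at $(k,t)$ or at least one of these two is infinite. It is an FPS point with respect to the smooth direction if the product of the principal curvatures $\kappa$ at $(k-1,t)$ and $(k,t)$ is negative, or that at $(k,t)$ and $(k+1,t)$ is negative, or at least one of the principal curvatures $\kappa$ at $(k-1,t),(k,t),(k+1,t)$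 is infinite.
   Formalization: The displayed strict conditions are proved equivalent to a negative product; ''nonpositive'' adds the case product = 0, ''FPS point'' adds infinite curvature, and a smooth FPS point uses the condition at (k-1,k) or (k,k+1), since the literal equivalences fail in these cases. *)

(* Defs.v *)
From HB Require Import structures.
From mathcomp Require Import all_boot all_order all_algebra.
From mathcomp Require Import all_classical all_reals all_analysis.
From mathcomp Require Export complex.

Set Implicit Arguments.
Unset Strict Implicit.
Unset Printing Implicit Defensive.
Import Order.TTheory GRing.Theory Num.Theory.
Import numFieldNormedType.Exports.
Local Open Scope classical_set_scope.
Local Open Scope complex_scope.
Local Open Scope ring_scope.

Section SemiDiscrete.
Variable R : realType.

(* A semi-discrete map is a total function int -> R -> V of which only the
   values on D are relevant, where D k is the slice {t | (k, t) in the domain};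
   the slices are required to be open. *)

Definition Delta (V : zmodType) (y : int -> R -> V) (k : int) (t : R) : V :=
  y (k + 1) t - y k t.

(* R[i] carries no R-normed structure in the libraries: derivatives of
   complex-valued functions of a real variable are taken on real and imaginary
   parts. *)
Definition cderivable (f : R -> R[i]) (t : R) : Prop :=
  derivable (fun u => complex.Re (f u)) t 1 /\
  derivable (fun u => complex.Im (f u)) t 1.

Definition cderive (f : R -> R[i]) (t : R) : R[i] :=
  'D_1 (fun u => complex.Re (f u)) t +i* 'D_1 (fun u => complex.Im (f u)) t.

Definition mx_cderivable m n (M : R -> 'M[R[i]]_(m, n)) (t : R) : Prop :=
  forall i j, cderivable (fun u => M u i j) t.

Definition mx_cderive m n (M : R -> 'M[R[i]]_(m, n)) (t : R) : 'M[R[i]]_(m, n) :=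
  \matrix_(i, j) cderive (fun u => M u i j) t.

Definition sqn (z : R[i]) : R := ComplexField.Normc.normc z ^+ 2.

Definition mx22 (a b c d : R[i]) : 'M[R[i]]_2 :=
  \matrix_(i < 2, j < 2)
    if i == 0 then (if j == 0 then a else b) else (if j == 0 then c else d).

Definition ctrmx (A : 'M[R[i]]_2) : 'M[R[i]]_2 := (map_mx (@conjc R) A)^T.

(* The points of R^{3,1} are rows (z1, z2, z3, z0), the timelike coordinate
   last; minus the determinant of mx_of_point z is the squared norm of z. *)
Definition mx_of_point (z : 'rV[R]_4) : 'M[R[i]]_2 :=
  let z1 := z 0 (inord 0) in let z2 := z 0 (inord 1) in
  let z3 := z 0 (inord 2) in let z0 := z 0 (inord 3) in
  mx22 (z0 + z3)%:C (z1 -i* z2) (z1 +i* z2) (z0 - z3)%:C.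

Record semidiscrete_holomorphic (D : int -> set R) (g : int -> R -> R[i])
    (tau : R -> R) (sigma : int -> R) : Prop := SemidiscreteHolomorphic {
  sdh_derivable : forall k t, D k t -> cderivable (g k) t;
  sdh_deriv_neq0 : forall k t, D k t -> cderive (g k) t != 0;
  sdh_Delta_neq0 : forall k t, D k t -> D (k + 1) t -> Delta g k t != 0;
  sdh_cross : forall k t, D k t -> D (k + 1) t ->
    cderive (g k) t * cderive (g (k + 1)) t / Delta g k t ^+ 2
      = (tau t / sigma k)%:C;
  sdh_cross_lt0 : forall k t, D k t -> D (k + 1) t -> tau t / sigma k < 0 }.

Definition calT (s : R) (z : R[i]) : R := 1 + s * sqn z.

(* sqrtC is the complex square root, since calT s z may be negative. *)
Definition Lmx (s : R) (z : R[i]) : 'M[R[i]]_2 :=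
  let r := sqrtC (calT s z)%:C in
  mx22 0 r (- 1 / r) (- s%:C * conjc z / r).

(* x and n take values in R^{3,1}, so wr_x forces the right-hand side to be
   Hermitian, hence det E to be real; x then lies in H^3 (determinant 1) and n
   in S^{2,1} (determinant -1). *)
Record weierstrass (D : int -> set R) (g : int -> R -> R[i])
    (tau : R -> R) (sigma : int -> R) (s lambda : R)
    (E : int -> R -> 'M[R[i]]_2) (x n : int -> R -> 'rV[R]_4) : Prop :=
  Weierstrass {
  wr_open : forall k, open (D k);
  wr_holomorphic : semidiscrete_holomorphic D g tau sigma;
  wr_calT_neq0 : forall k t, D k t -> calT s (g k t) != 0;
  wr_lambda_neq0 : lambda != 0;
  wr_regular : forall k t, D k t -> D (k + 1) t -> 1 - lambda * sigma k != 0;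
  wr_E_unit : forall k t, D k t -> E k t \in unitmx;
  wr_E_derivable : forall k t, D k t -> mx_cderivable (E k) t;
  wr_E_Delta : forall k t, D k t -> D (k + 1) t ->
    invmx (E k t) *m Delta E k t
      = mx22 0 (Delta g k t) ((lambda * sigma k)%:C / Delta g k t) 0;
  wr_E_deriv : forall k t, D k t ->
    invmx (E k t) *m mx_cderive (E k) t
      = mx22 0 (cderive (g k) t) ((lambda * tau t)%:C / cderive (g k) t) 0;
  wr_x : forall k t, D k t ->
    let EL := E k t *m Lmx s (g k t) in
    mx_of_point (x k t)
      = ((Num.sg (calT s (g k t)))%:C / \det (E k t)) *: (EL *m ctrmx EL);
  wr_n : forall k t, D k t ->
    let EL := E k t *m Lmx s (g k t) in
    mx_of_point (n k t)
      = ((Num.sg (calT s (g k t)))%:C / \det (E k t)) *: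
          (EL *m mx22 1 0 0 (- 1) *m ctrmx EL) }.

(* A principal curvature is a real number or infinite (None); it is infinite
   when the surface does not move but its normal does. *)
Definition is_curvature (dy dnu : 'rV[R]_4) (kappa : option R) : Prop :=
  match kappa with
  | Some c => dy != 0 /\ dnu = - c *: dy
  | None => dy = 0 /\ dnu != 0
  end.

(* kap k t is the curvature at (k, t) in the smooth direction, kap01 k t the
   curvature of the edge joining (k, t) and (k + 1, t); hence kappa_{-10} at
   (k, t) is kap01 (k - 1) t. *)
Record principal_curvatures (D : int -> set R) (y nu : int -> R -> 'rV[R]_4)
    (kap kap01 : int -> R -> option R) : Prop := PrincipalCurvatures {
  pc_surf_derivable : forall k t, D k t -> derivable (y k) t 1;
  pc_normal_derivable : forall k t, D k t -> derivable (nu k) t 1;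
  pc_smooth : forall k t, D k t ->
    is_curvature ('D_1 (y k) t) ('D_1 (nu k) t) (kap k t);
  pc_discrete : forall k t, D k t -> D (k + 1) t ->
    is_curvature (Delta y k t) (Delta nu k t) (kap01 k t) }.

(* Signs of a product of two curvatures; they presuppose finite factors. *)
Definition prod_neg (c d : option R) : Prop :=
  if (c, d) is (Some a, Some b) then a * b < 0 else False.
Definition prod_nonpos (c d : option R) : Prop :=
  if (c, d) is (Some a, Some b) then a * b <= 0 else False.
Definition prod_zero (c d : option R) : Prop :=
  if (c, d) is (Some a, Some b) then a * b = 0 else False.

Definition FPS_discrete (kap01 : int -> R -> option R) (k : int) (t : R) :=
  prod_neg (kap01 (k - 1) t) (kap01 k t) \/
  (kap01 (k - 1) t = None \/ kap01 k t = None).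

Definition FPS_smooth (kap : int -> R -> option R) (k : int) (t : R) :=
  prod_neg (kap (k - 1) t) (kap k t) \/ prod_neg (kap k t) (kap (k + 1) t) \/
  [\/ kap (k - 1) t = None, kap k t = None | kap (k + 1) t = None].

Definition cond_discrete (g : int -> R -> R[i]) (sigma : int -> R)
    (s lambda : R) (k : int) (t : R) : Prop :=
  let am := 1 + s * sqn (g (k - 1) t) in
  let a0 := 1 + s * sqn (g k t) in
  let a1 := 1 + s * sqn (g (k + 1) t) in
  let dm := sqn (g k t - g (k - 1) t) in
  let d0 := sqn (g (k + 1) t - g k t) in
  let P := (dm * (1 + s) - lambda * sigma (k - 1) * am * a0) *
           (d0 * (1 + s) - lambda * sigma k * a0 * a1) in
  let Q := (dm * (1 - s) + lambda * sigma (k - 1) * am * a0) *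
           (d0 * (1 - s) + lambda * sigma k * a0 * a1) in
  (P > 0 /\ Q < 0) \/ (P < 0 /\ Q > 0).

Definition cond_smooth (g : int -> R -> R[i]) (tau : R -> R)
    (s lambda : R) (k : int) (t : R) : Prop :=
  let a0 := 1 + s * sqn (g k t) in
  let a1 := 1 + s * sqn (g (k + 1) t) in
  let d0 := sqn (cderive (g k) t) in
  let d1 := sqn (cderive (g (k + 1)) t) in
  let P := (d0 * (1 + s) - lambda * tau t * a0 ^+ 2) *
           (d1 * (1 + s) - lambda * tau t * a1 ^+ 2) in
  let Q := (d0 * (1 - s) + lambda * tau t * a0 ^+ 2) *
           (d1 * (1 - s) + lambda * tau t * a1 ^+ 2) in
  (P > 0 /\ Q < 0) \/ (P < 0 /\ Q > 0).

End SemiDiscrete.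

(* Main.v *)
(* In the frame [E] the pair x + n, x - n becomes a pair of rank one Hermitian
   matrices 2 P, 2 Q, and along an edge or along t the increment of Q is a real
   multiple of that of P: dQ = rho dP, with
     rho = lambda sigma T T_1 / |Delta g|^2 - s  on an edge,
     rho = lambda tau T^2 / |g'|^2 - s           in the smooth direction.
   Hence dx = (1 + rho) dP and dn = (1 - rho) dP, with dP nonzero, so that
   kappa^x = - (1 - rho) / (1 + rho) and kappa^n is its inverse. After
   multiplication by |Delta g|^2 or |g'|^2, numerators and denominators are the
   factors in the braces of the two conditions. *)
Require Import Defs.
From HB Require Import structures.
From mathcomp Require Import all_boot all_order all_algebra.
From mathcomp Require Import all_classical all_reals all_analysis.
From mathcomp Require Import ring lra.

Set Implicit Arguments.
Unset Strict Implicit.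
Unset Printing Implicit Defensive.
Import Order.TTheory GRing.Theory Num.Theory.
Import numFieldNormedType.Exports.
Local Open Scope classical_set_scope.
Local Open Scope complex_scope.
Local Open Scope ring_scope.

(** * Differential calculus for complex functions of a real variable *)

Section ComplexDerivative.
Variable R : realType.
Implicit Types (f h : R -> R[i]) (t : R) (df dh : R[i]).

(** Existence and value are kept in one relation, so that the rules below compose without separate
    derivability arguments. *)
Definition is_cderive f t df : Prop :=
  is_derive t 1 (fun u => complex.Re (f u)) (complex.Re df) /\
  is_derive t 1 (fun u => complex.Im (f u)) (complex.Im df).

Lemma cderivableP f t : cderivable f t -> is_cderive f t (cderive f t).
Proof. by move=> [? ?]; split; exact: derivableP. Qed.

Lemma is_cderive_unique f t df dh :
  is_cderive f t df -> is_cderive f t dh -> df = dh.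
Proof.
move=> [fr fi] [hr hi]; apply/eqP; rewrite eq_complex.
rewrite -(@derive_val _ _ _ _ _ _ _ fr) -(@derive_val _ _ _ _ _ _ _ fi).
by rewrite (@derive_val _ _ _ _ _ _ _ hr) (@derive_val _ _ _ _ _ _ _ hi) !eqxx.
Qed.

Lemma near_eq_is_cderive f h t df :
  (\near t, f t = h t) -> is_cderive f t df -> is_cderive h t df.
Proof.
move=> fh [fr fi]; split.
- by apply: (near_eq_is_derive _ fr); apply: filterS fh => u ->.
- by apply: (near_eq_is_derive _ fi); apply: filterS fh => u ->.
Qed.

Lemma is_cderive_cst t (c : R[i]) : is_cderive (fun=> c) t 0.
Proof. by split; exact: is_derive_cst. Qed.

Lemma is_cderiveD f h t df dh : is_cderive f t df -> is_cderive h t dh ->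
  is_cderive (fun u => f u + h u) t (df + dh).
Proof.
move=> [fr fi] [hr hi]; split.
- have -> : (fun u => complex.Re (f u + h u)) =
    (fun u => complex.Re (f u)) + (fun u => complex.Re (h u)).
    by apply/funext => u; rewrite raddfD.
  by apply: is_derive_eq; rewrite raddfD.
- have -> : (fun u => complex.Im (f u + h u)) =
    (fun u => complex.Im (f u)) + (fun u => complex.Im (h u)).
    by apply/funext => u; rewrite raddfD.
  by apply: is_derive_eq; rewrite raddfD.
Qed.

Lemma is_cderive_sum n (f : 'I_n -> R -> R[i]) t (df : 'I_n -> R[i]) :
  (forall i, is_cderive (f i) t (df i)) ->
  is_cderive (fun u => \sum_i f i u) t (\sum_i df i).
Proof.
elim: n f df => [|n IHn] f df fdf.
  rewrite big_ord0; under eq_fun do rewrite big_ord0.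
  exact: is_cderive_cst.
rewrite big_ord_recl; under eq_fun do rewrite big_ord_recl.
by apply: is_cderiveD => //; apply: IHn.
Qed.

Lemma is_cderiveM f h t df dh : is_cderive f t df -> is_cderive h t dh ->
  is_cderive (fun u => f u * h u) t (df * h t + f t * dh).
Proof.
move=> [fr fi] [hr hi]; split.
- have -> : (fun u => complex.Re (f u * h u)) =
    (fun u => complex.Re (f u)) * (fun u => complex.Re (h u)) -
    (fun u => complex.Im (f u)) * (fun u => complex.Im (h u)).
    by apply/funext => u; rewrite !fctE; case: (f u); case: (h u).
  apply: is_derive_eq; rewrite /GRing.scale /=.
  case: (f t) (h t) df dh {fr fi hr hi} => ? ? [? ?] [? ?] [? ?] /=; ring.
- have -> : (fun u => complex.Im (f u * h u)) =
    (fun u => complex.Re (f u)) * (fun u => complex.Im (h u)) +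
    (fun u => complex.Im (f u)) * (fun u => complex.Re (h u)).
    by apply/funext => u; rewrite !fctE; case: (f u); case: (h u).
  apply: is_derive_eq; rewrite /GRing.scale /=.
  case: (f t) (h t) df dh {fr fi hr hi} => ? ? [? ?] [? ?] [? ?] /=; ring.
Qed.

Lemma is_cderiveZ (c : R[i]) f t df : is_cderive f t df ->
  is_cderive (fun u => c * f u) t (c * df).
Proof. by move=> /(is_cderiveM (is_cderive_cst t c)); rewrite mul0r add0r. Qed.

Lemma is_cderiveN f t df : is_cderive f t df ->
  is_cderive (fun u => - f u) t (- df).
Proof.
move=> /(is_cderiveZ (-1)); rewrite mulN1r.
by under eq_fun do rewrite mulN1r.
Qed.

Lemma is_cderive_conjc f t df : is_cderive f t df ->
  is_cderive (fun u => conjc (f u)) t (conjc df).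
Proof.
move=> [fr fi]; split.
- have -> : (fun u => complex.Re (conjc (f u))) = (fun u => complex.Re (f u)).
    by apply/funext => u; case: (f u).
  by case: df fr fi.
- have -> : (fun u => complex.Im (conjc (f u))) =
    - (fun u => complex.Im (f u)) by apply/funext => u; rewrite fctE; case: (f u).
  by case: df fr fi => a b /= fr fi; exact: is_deriveN.
Qed.

Lemma is_cderive_real (f : R -> R) t (df : R) : is_derive t 1 f df ->
  is_cderive (fun u => (f u)%:C) t df%:C.
Proof. by move=> fdf; split; [exact: fdf|exact: is_derive_cst]. Qed.

Lemma mulc_conjc_real (z : R[i]) : (complex.Re (z * conjc z))%:C = z * conjc z.
Proof. by case: z => a b; simpc; rewrite [b * a]mulrC addNr. Qed.

(** Writing 1/f as the conjugate of f over |f|^2 leaves only the inverse of a real function to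
    differentiate. *)
Lemma is_cderiveV f t df : f t != 0 -> is_cderive f t df ->
  is_cderive (fun u => (f u)^-1) t (- df / f t ^+ 2).
Proof.
move=> ft0 fdf; pose q u := complex.Re (f u * conjc (f u)).
have qE u : (q u)%:C = f u * conjc (f u) by exact: mulc_conjc_real.
have dqq := is_cderiveM fdf (is_cderive_conjc fdf).
have cft0 : conjc (f t) != 0 by rewrite conjc_eq0.
have qt0 : q t != 0.
  apply/eqP => q0; have := qE t; rewrite q0 => /esym/eqP.
  by rewrite mulf_eq0 (negPf ft0) (negPf cft0).
have dV := is_cderive_real (is_deriveV qt0 (proj1 dqq)).
(* At a zero of [f] both sides are 0, since 0 inverts to 0; the identity therefore holds for every
   [u], not only near [t]. *)
have -> : (fun u => (f u)^-1) = (fun u => conjc (f u) * (q u)^-1%:C).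
  apply/funext => u; rewrite fmorphV /= qE.
  have [->|fu0] := eqVneq (f u) 0; first by rewrite mul0r !invr0 mulr0.
  by rewrite invfM mulrCA mulfV ?mulr1// conjc_eq0.
suff -> : - df / f t ^+ 2 = conjc df * (q t)^-1%:C + conjc (f t) *
    (- q t ^- 2 *: complex.Re (df * conjc (f t) + f t * conjc df))%:C.
  exact: is_cderiveM (is_cderive_conjc fdf) dV.
have -> : (- q t ^- 2 *: complex.Re (df * conjc (f t) + f t * conjc df))%:C =
    - (f t * conjc (f t)) ^- 2 * (df * conjc (f t) + f t * conjc df).
  rewrite /GRing.scale /= rmorphM rmorphN fmorphV rmorphXn /= qE; congr (_ * _).
  by case: (f t) df {fdf dqq dV cft0 ft0 qE qt0} => a b [c d]; simpc;
    congr (_ +i* _); ring.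
by rewrite fmorphV /= qE; field; apply/andP.
Qed.

End ComplexDerivative.

(** * Entrywise differentiation of matrix curves *)

Section MatrixDerivative.
Variable R : realType.
Implicit Types t : R.

Definition is_mxderive m n (F : R -> 'M[R[i]]_(m, n)) t (dF : 'M[R[i]]_(m, n)) :=
  forall i j, is_cderive (fun u => F u i j) t (dF i j).

Lemma mx_cderivableP m n (F : R -> 'M[R[i]]_(m, n)) t :
  mx_cderivable F t -> is_mxderive F t (mx_cderive F t).
Proof. by move=> dF i j; rewrite mxE; exact: cderivableP. Qed.

Lemma is_mxderive_unique m n (F : R -> 'M[R[i]]_(m, n)) t dF dG :
  is_mxderive F t dF -> is_mxderive F t dG -> dF = dG.
Proof. by move=> FdF FdG; apply/matrixP => i j; exact: is_cderive_unique. Qed.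

Lemma near_eq_is_mxderive m n (F G : R -> 'M[R[i]]_(m, n)) t dF :
  (\near t, F t = G t) -> is_mxderive F t dF -> is_mxderive G t dF.
Proof.
move=> FG FdF i j; apply: near_eq_is_cderive (FdF i j).
by apply: filterS FG => u ->.
Qed.

Lemma is_mxderiveM m n p (F : R -> 'M[R[i]]_(m, n)) (G : R -> 'M[R[i]]_(n, p))
    t dF dG : is_mxderive F t dF -> is_mxderive G t dG ->
  is_mxderive (fun u => F u *m G u) t (dF *m G t + F t *m dG).
Proof.
move=> FdF GdG i j; rewrite !mxE -big_split /=.
under eq_fun do rewrite mxE.
by apply: is_cderive_sum => l; exact: is_cderiveM.
Qed.

Lemma is_mxderiveZ m n (c : R -> R[i]) (F : R -> 'M[R[i]]_(m, n)) t dc dF :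
  is_cderive c t dc -> is_mxderive F t dF ->
  is_mxderive (fun u => c u *: F u) t (dc *: F t + c t *: dF).
Proof.
move=> cdc FdF i j; rewrite !mxE; under eq_fun do rewrite mxE.
exact: is_cderiveM.
Qed.

Lemma is_mxderive_ctrmx (F : R -> 'M[R[i]]_2) t dF : is_mxderive F t dF ->
  is_mxderive (fun u => ctrmx (F u)) t (ctrmx dF).
Proof.
move=> FdF i j; rewrite !mxE; under eq_fun do rewrite !mxE.
exact: is_cderive_conjc.
Qed.

Lemma det_mx22 (A : 'M[R[i]]_2) : \det A = A 0 0 * A 1 1 - A 0 1 * A 1 0.
Proof.
rewrite (expand_det_row _ 0) !big_ord_recl big_ord0 /cofactor !det_mx11 !mxE /=.
rewrite addr0 expr0 expr1 mul1r mulN1r mulrN.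
by congr (_ * A _ _ - A _ _ * A _ _); exact: val_inj.
Qed.

(** Jacobi's formula for a curve with logarithmic derivative [V]. For a traceless [V], such as the
    connection matrix, the derivative of the determinant is zero. *)
Lemma is_cderive_det (F : R -> 'M[R[i]]_2) t (V : 'M[R[i]]_2) :
  is_mxderive F t (F t *m V) ->
  is_cderive (fun u => \det (F u)) t (\tr V * \det (F t)).
Proof.
move=> FdF; under eq_fun do rewrite det_mx22.
have := is_cderiveD (is_cderiveM (FdF 0 0) (FdF 1 1))
                    (is_cderiveN (is_cderiveM (FdF 0 1) (FdF 1 0))).
congr (is_cderive _ _ _); rewrite det_mx22 /mxtrace !mxE !big_ord_recl !big_ord0.
have -> : lift ord0 ord0 = 1 :> 'I_2 by exact: val_inj.
rewrite /=; ring.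
Qed.

End MatrixDerivative.

(** * Explicit two by two matrices and conjugate transposes *)

Section TwoByTwo.
Variable R : realType.
Implicit Types (A B : 'M[R[i]]_2).

Lemma eq_mx22P A B : A 0 0 = B 0 0 -> A 0 1 = B 0 1 -> A 1 0 = B 1 0 ->
  A 1 1 = B 1 1 -> A = B.
Proof.
move=> e00 e01 e10 e11; apply/matrixP.
have ord2P (l : 'I_2) : l = 0 \/ l = 1.
  by case: l => -[|[|//]] ?; [left|right]; exact: val_inj.
by move=> i j; case: (ord2P i) => ->; case: (ord2P j) => ->.
Qed.

Lemma mx22_mul (a b c d a' b' c' d' : R[i]) :
  mx22 a b c d *m mx22 a' b' c' d' =
  mx22 (a * a' + b * c') (a * b' + b * d') (c * a' + d * c') (c * b' + d * d').
Proof. by apply: eq_mx22P; rewrite !mxE !big_ord_recl big_ord0 addr0 !mxE. Qed.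

Lemma mx22_add (a b c d a' b' c' d' : R[i]) :
  mx22 a b c d + mx22 a' b' c' d' = mx22 (a + a') (b + b') (c + c') (d + d').
Proof. by apply: eq_mx22P; rewrite !mxE. Qed.

Lemma mx22_sub (a b c d a' b' c' d' : R[i]) :
  mx22 a b c d - mx22 a' b' c' d' = mx22 (a - a') (b - b') (c - c') (d - d').
Proof. by apply: eq_mx22P; rewrite !mxE. Qed.

Lemma mx22_scale (e a b c d : R[i]) :
  e *: mx22 a b c d = mx22 (e * a) (e * b) (e * c) (e * d).
Proof. by apply: eq_mx22P; rewrite !mxE. Qed.

Lemma mx22_1 : 1%:M = mx22 1 0 0 1 :> 'M[R[i]]_2.
Proof. by apply: eq_mx22P; rewrite !mxE. Qed.

Lemma ctrmx22 (a b c d : R[i]) :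
  ctrmx (mx22 a b c d) = mx22 (conjc a) (conjc c) (conjc b) (conjc d).
Proof. by apply: eq_mx22P; rewrite !mxE. Qed.

Lemma ctrmxM A B : ctrmx (A *m B) = ctrmx B *m ctrmx A.
Proof. by rewrite /ctrmx map_mxM trmx_mul. Qed.

Lemma ctrmx_unit A : A \in unitmx -> ctrmx A \in unitmx.
Proof. by move=> Au; rewrite unitmx_tr map_unitmx. Qed.

End TwoByTwo.

(** * Points of Minkowski space as Hermitian matrices *)

Section MinkowskiPoints.
Variable R : realType.

Lemma mx_of_pointB (y z : 'rV[R]_4) :
  mx_of_point (y - z) = mx_of_point y - mx_of_point z.
Proof.
by apply: eq_mx22P; rewrite !mxE /=; apply/eqP; rewrite eq_complex /=;
  apply/andP; split; apply/eqP; ring.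
Qed.

Lemma mx_of_pointZ (c : R) (y : 'rV[R]_4) :
  mx_of_point (c *: y) = c%:C *: mx_of_point y.
Proof.
by apply: eq_mx22P; rewrite !mxE /=; apply/eqP; rewrite eq_complex /=;
  apply/andP; split; apply/eqP; ring.
Qed.

Lemma ord4P (P : 'I_4 -> Prop) : P (inord 0) -> P (inord 1) -> P (inord 2) ->
  P (inord 3) -> forall j, P j.
Proof.
by move=> ? ? ? ? j; rewrite -(inord_val j); case: j => -[|[|[|[|//]]]].
Qed.

Lemma mx_of_point_inj : injective (@mx_of_point R).
Proof.
move=> y z /matrixP yz.
have := (yz 0 0, yz 0 1, yz 1 0, yz 1 1); rewrite !mxE /=.
move=> [[[[e1] [e2 e3]] _] [e4]].
by apply/rowP; apply: ord4P => //; [exact: oppr_inj|lra|lra].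
Qed.

(** The four coordinates are real linear combinations of real and imaginary parts of the entries, so
    derivability passes from the matrix to the point. *)
Lemma is_mxderive_mx_of_point (y : R -> 'rV[R]_4) (t : R) M :
  is_mxderive (fun u => mx_of_point (y u)) t M ->
  derivable y t 1 /\ mx_of_point ('D_1 y t) = M.
Proof.
move=> yM; have [d00 _] := yM 0 0; have [d11 _] := yM 1 1.
have [d1 d2] := yM 1 0.
have yt : derivable y t 1.
  apply/derivable_mxP => i; rewrite ord1; apply: ord4P.
  - apply: (@ex_derive _ _ _ _ _ _ (complex.Re (M 1 0))).
    by move: d1; under eq_fun do rewrite !mxE /=.
  - apply: (@ex_derive _ _ _ _ _ _ (complex.Im (M 1 0))).
    by move: d2; under eq_fun do rewrite !mxE /=.
  - have -> : (fun u => y u 0 (inord 2)) = 2^-1 \*: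
      ((fun u => complex.Re (mx_of_point (y u) 0 0)) -
       (fun u => complex.Re (mx_of_point (y u) 1 1))).
      by apply/funext => u; rewrite !fctE /= !mxE /= /GRing.scale /=; field.
    by apply: derivableZ; apply: derivableB.
  - have -> : (fun u => y u 0 (inord 3)) = 2^-1 \*:
      ((fun u => complex.Re (mx_of_point (y u) 0 0)) +
       (fun u => complex.Re (mx_of_point (y u) 1 1))).
      by apply/funext => u; rewrite !fctE /= !mxE /= /GRing.scale /=; field.
    by apply: derivableZ; apply: derivableD.
(* Conversely, the derivatives of the coordinates differentiate the matrix, and uniqueness
   identifies the result with [M]. *)
split=> //; apply: is_mxderive_unique yM => i j.
have dy (l : 'I_4) : is_derive t 1 (fun u => y u 0 l) ('D_1 y t 0 l).
  by rewrite (derive_mx yt) mxE; apply: derivableP; move/derivable_mxP : yt.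
rewrite !mxE; under eq_fun do rewrite mxE.
case: (i == 0); case: (j == 0); split=> /=.
- exact: (is_deriveD (dy _) (dy _)).
- exact: is_derive_cst.
- exact: dy.
- exact: (is_deriveN (dy _)).
- exact: dy.
- exact: dy.
- exact: (is_deriveB (dy _) (dy _)).
- exact: is_derive_cst.
Qed.

End MinkowskiPoints.

(** * Surface and normal seen in the frame, with their increments *)

Section Frame.
Variable R : realType.

Lemma sqnE (z : R[i]) : (sqn z)%:C = z * conjc z.
Proof.
case: z => a b.
rewrite /sqn /ComplexField.Normc.normc sqr_sqrtr ?addr_ge0 ?sqr_ge0//.
by simpc; apply/eqP; rewrite eq_complex /=; apply/andP; split; apply/eqP; ring.
Qed.

Lemma sqn_ge0 (z : R[i]) : 0 <= sqn z. Proof. exact: sqr_ge0. Qed.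

Lemma sqn_gt0 (z : R[i]) : z != 0 -> 0 < sqn z.
Proof.
move=> z0; rewrite lt0r sqn_ge0 andbT; apply: contra z0 => /eqP sqn0.
have := sqnE z; rewrite sqn0 => /esym/eqP.
by rewrite mulf_eq0 conjc_eq0 orbb.
Qed.

Lemma calTE (s : R) (z : R[i]) :
  (calT s z)%:C = 1 + s%:C * (z * conjc z).
Proof. by rewrite rmorphD rmorph1 rmorphM /= sqnE. Qed.

(* [sgn T * L * diag(1, e) * L^*] at [g = z], for [e = 1] (surface) and
   [e = - 1] (normal). It is affine in [e] with two terms of rank one. *)
Definition Wmx (e : R[i]) (s : R) (z : R[i]) : 'M[R[i]]_2 :=
  mx22 (e * (calT s z)%:C) (- e * s%:C * z) (- e * s%:C * conjc z)
    ((1 + e * s%:C ^+ 2 * (z * conjc z)) / (calT s z)%:C).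

Lemma sqrtC_mul_conj (a : R) : 
  sqrtC a%:C * conjc (sqrtC a%:C) = `|a|%:C.
Proof.
rewrite -sqr_normc -normrX sqrtCK. 
by rewrite normc_def /= expr0n /= addr0 sqrtr_sqr.
Qed.

(** When [calT s z] is negative its root is imaginary and conjugating it costs a sign. The factor
    [Num.sg] absorbs that sign, so one formula serves both cases. *)
Lemma Lmx_Wmx (e : R[i]) (s : R) (z : R[i]) : calT s z != 0 ->
  (Num.sg (calT s z))%:C *:
    (Lmx s z *m mx22 1 0 0 e *m ctrmx (Lmx s z)) = Wmx e s z.
Proof.
rewrite /Lmx /Wmx; move: (calT s z) => T T0; set r := sqrtC _.
have rr : r ^+ 2 = T%:C by exact: sqrtCK.
have r0 : r != 0 by rewrite -sqrf_eq0 rr fmorph_eq0.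
have sgT : (Num.sg T)%:C ^+ 2 = 1 by rewrite -rmorphXn /= sqr_sg T0.
have sg0 : (Num.sg T)%:C != 0 by rewrite fmorph_eq0 sgr_eq0.
(* The product of [r] with its conjugate is |T|, while [r ^+ 2] is T. *)
have cr : conjc r = (Num.sg T)%:C * r.
  apply: (mulfI r0); rewrite sqrtC_mul_conj normrEsg rmorphM /=.
  by rewrite mulrCA -expr2 rr.
have crS := conjc_real s.
move: (s%:C) (T%:C) (Num.sg T)%:C crS rr sgT sg0 cr => S T' sg crS <- sgT sg0 cr.
rewrite ctrmx22 !mx22_mul mx22_scale.
rewrite !(rmorphN, rmorphM, rmorph0, rmorph1, fmorphV) /= crS conjcK cr.
move: (conjc z) => zb; congr mx22.
- ring: sgT.
- by field: sgT; rewrite ?r0 ?sg0.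
- by field: sgT; rewrite ?r0 ?sg0.
- by field: sgT; rewrite ?r0 ?sg0.
Qed.

(* Both connection matrices: [p = Delta g], [m = lambda sigma] on an edge, and
   [p = g'], [m = lambda tau] in the smooth direction. *)
Definition conn_mx (p m : R[i]) : 'M[R[i]]_2 := mx22 0 p (m / p) 0.

(** This is dP on an edge: since [Wmx e] is P + e Q, it is the left-hand side of [Wmx_edge] at
    [e = 0]. *)
Definition edge_dir (s : R) (z z1 m : R[i]) : 'M[R[i]]_2 :=
  let p := z1 - z in
  let T := (calT s z)%:C in let T1 := (calT s z1)%:C in
  ((1 - m) * T1)^-1 *:
    mx22 (p * conjc p) p (conjc p) ((T - (1 - m) * T1) / T).

(** [F] is the transition matrix from one frame to the next and [1 - m] its determinant, so the
    left-hand side is the edge increment pulled back to the first frame. *)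
Lemma Wmx_edge (e : R[i]) (s m : R) (z z1 : R[i]) :
  calT s z != 0 -> calT s z1 != 0 -> z1 - z != 0 -> 1 - m != 0 ->
  let F := 1%:M + conn_mx (z1 - z) m%:C in
  (1 - m%:C)^-1 *: (F *m Wmx e s z1 *m ctrmx F) - Wmx e s z =
  (1 + e * (m * calT s z * calT s z1 / sqn (z1 - z) - s)%:C) *:
    edge_dir s z z1 m%:C.
Proof.
move=> T0 T10 p0 m0 /=; rewrite mx22_1 /conn_mx mx22_add !addr0 !add0r ctrmx22.
rewrite /Wmx !mx22_mul !mx22_scale mx22_sub /edge_dir !mx22_scale.
have TC0 : (calT s z)%:C != 0 by rewrite fmorph_eq0.
have T1C0 : (calT s z1)%:C != 0 by rewrite fmorph_eq0.
have mC0 : 1 - m%:C != 0 by rewrite -(rmorph1 (real_complex R)) -rmorphB fmorph_eq0.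
have q0 : conjc z1 - conjc z != 0 by rewrite -rmorphB conjc_eq0.
have -> : (m * calT s z * calT s z1 / sqn (z1 - z) - s)%:C =
    m%:C * (calT s z)%:C * (calT s z1)%:C / ((z1 - z) * (conjc z1 - conjc z)) - s%:C.
  by rewrite rmorphB fmorph_div /= sqnE rmorphB /= !rmorphM.
move: m%:C (conjc_real m) mC0 => M cM mC0.
rewrite conjc1 fmorph_div /= cM !rmorphB /=.
move: TC0 T1C0; rewrite !calTE.
(* With the conjugates taken as independent variables, each entry becomes an identity of rational
   functions. *)
move: (s%:C) (conjc z) (conjc z1) q0 => S zb z1b q0 TC0 T1C0.
by congr mx22; field; rewrite ?TC0 ?T1C0 ?p0 ?q0 ?mC0.
Qed.

Lemma edge_dir_neq0 (s m : R) (z z1 : R[i]) : calT s z1 != 0 -> z1 - z != 0 ->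
  1 - m != 0 -> edge_dir s z z1 m%:C != 0.
Proof.
(* The upper off-diagonal entry is [z1 - z] divided by a nonzero real. *)
move=> T10 p0 m0; apply/eqP => /matrixP/(_ 0 1); rewrite !mxE /=.
apply/eqP; rewrite mulf_neq0// invr_eq0 mulf_neq0 ?fmorph_eq0//.
by rewrite -(rmorph1 (real_complex R)) -rmorphB fmorph_eq0.
Qed.

(* The derivatives of [calT s g] and of [Wmx e s g] when [g' = p] at [g = z]. *)
Definition dcalT (s : R) (z p : R[i]) : R[i] :=
  s%:C * (p * conjc z + z * conjc p).

Definition dWmx (e : R[i]) (s : R) (z p : R[i]) : 'M[R[i]]_2 :=
  mx22 (e * dcalT s z p) (- e * s%:C * p) (- e * s%:C * conjc p)
    (e * s%:C * dcalT s z p / (calT s z)%:C -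
     (1 + e * s%:C ^+ 2 * (z * conjc z)) * dcalT s z p / (calT s z)%:C ^+ 2).

(** The smooth counterpart of [edge_dir]: dP, obtained from [Wmx_smooth] at [e = 0]. *)
Definition smooth_dir (s : R) (z p : R[i]) : 'M[R[i]]_2 :=
  let T := (calT s z)%:C in
  T^-1 *: mx22 0 p (conjc p) (- dcalT s z p / T).

(** The left-hand side is what the product rule gives for [E *m Wmx *m ctrmx E] when the derivative
    of [E] is [E *m V], with the outer factors stripped. *)
Lemma Wmx_smooth (e : R[i]) (s m : R) (z p : R[i]) :
  calT s z != 0 -> p != 0 ->
  let V := conn_mx p m%:C in
  V *m Wmx e s z + dWmx e s z p + Wmx e s z *m ctrmx V =
  (1 + e * (m * calT s z ^+ 2 / sqn p - s)%:C) *: smooth_dir s z p.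
Proof.
move=> T0 p0 /=; rewrite /conn_mx ctrmx22.
rewrite /Wmx /dWmx /smooth_dir /dcalT !mx22_mul !mx22_scale !mx22_add.
have TC0 : (calT s z)%:C != 0 by rewrite fmorph_eq0.
have q0 : conjc p != 0 by rewrite conjc_eq0.
have -> : (m * calT s z ^+ 2 / sqn p - s)%:C =
    m%:C * (calT s z)%:C ^+ 2 / (p * conjc p) - s%:C.
  by rewrite rmorphB fmorph_div /= sqnE !rmorphM.
move: m%:C (conjc_real m) => M cM.
rewrite conjc0 fmorph_div /= cM.
move: TC0; rewrite !calTE.
move: (s%:C) (conjc z) (conjc p) q0 => S zb q q0 TC0.
by congr mx22; field; rewrite ?TC0 ?p0 ?q0.
Qed.

Lemma smooth_dir_neq0 (s : R) (z p : R[i]) : calT s z != 0 -> p != 0 ->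
  smooth_dir s z p != 0.
Proof.
move=> T0 p0; apply/eqP => /matrixP/(_ 0 1); rewrite !mxE /=.
by apply/eqP; rewrite mulf_neq0// invr_eq0 fmorph_eq0.
Qed.

Lemma is_mxderive_Wmx (e : R[i]) (s : R) (f : R -> R[i]) (t : R) (p : R[i]) :
  calT s (f t) != 0 -> is_cderive f t p ->
  is_mxderive (fun u => Wmx e s (f u)) t (dWmx e s (f t) p).
Proof.
move=> T0 fp; have cfp := is_cderive_conjc fp.
have dq := is_cderiveM fp cfp.
have TC0 : (calT s (f t))%:C != 0 by rewrite fmorph_eq0.
have dT : is_cderive (fun u => (calT s (f u))%:C) t (dcalT s (f t) p).
  under eq_fun do rewrite calTE.
  rewrite -[dcalT _ _ _]add0r; apply: is_cderiveD; first exact: is_cderive_cst.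
  exact: is_cderiveZ.
move=> i j; rewrite mxE; under eq_fun do rewrite mxE.
case: (i == 0); case: (j == 0); [exact: is_cderiveZ..|].
have := is_cderiveM (is_cderiveD (is_cderive_cst t 1)
  (is_cderiveZ (e * s%:C ^+ 2) dq))
  (@is_cderiveV _ (fun u => (calT s (f u))%:C) t _ TC0 dT).
by congr is_cderive; rewrite /dcalT add0r; field.
Qed.

End Frame.

(** * Curvatures as ratios, and signs of their products *)

Section Curvature.
Variable R : realType.
Implicit Types (a b : R) (dy dnu w : 'rV[R]_4).

(** The ratio is kept as a pair [a], [b] not both zero: this covers infinite curvature ([b = 0]) and
    lets surface and normal exchange roles by swapping the pair. *)
Definition proportional a b dy dnu : Prop :=
  a + b != 0 /\ exists2 w, w != 0 & dy = b *: w /\ dnu = a *: w.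

Definition curvature_of a b : option R := if b == 0 then None else Some (- (a / b)).

Definition opposite_signs a b : Prop := (a > 0 /\ b < 0) \/ (a < 0 /\ b > 0).

Lemma proportional_sym a b dy dnu :
  proportional a b dy dnu -> proportional b a dnu dy.
Proof. by rewrite /proportional addrC => -[? [w w0 []]]; split=> //; exists w. Qed.

(** The scalar [d] is there to clear the denominator of [r]; it will be |Delta g|^2 or |g'|^2. The
    two coefficients add up to [2 * d], hence the nonvanishing. *)
Lemma proportionalW (d r : R) dy dnu (K : 'M[R[i]]_2) : d != 0 -> K != 0 ->
  mx_of_point dy = (1 + 1 * r%:C) *: K ->
  mx_of_point dnu = (1 + - 1 * r%:C) *: K ->
  proportional (d * (1 - r)) (d * (1 + r)) dy dnu.
Proof.
move=> d0 K0; rewrite mul1r mulN1r => dyE dnuE; split.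
  have -> : d * (1 - r) + d * (1 + r) = 2 * d by ring.
  by rewrite mulf_neq0.
(* As 1 + r and 1 - r add up to 2, half the sum of the increments has matrix [K]; in particular [K]
   comes from a real point. *)
have KE : mx_of_point (2^-1 *: (dy + dnu)) = K.
  rewrite -[dnu]opprK mx_of_pointZ mx_of_pointB -[- dnu]scaleN1r mx_of_pointZ.
  rewrite rmorphN rmorph1 scaleN1r opprK dyE dnuE -scalerDl scalerA.
  have -> : 1 + r%:C + (1 - r%:C) = 2%:C :> R[i].
    by rewrite -[2]/(1 + 1) rmorphD rmorph1; ring.
  by rewrite -rmorphM /= mulVf// scale1r.
move: (2^-1 *: (dy + dnu)) KE => w KE.
exists (d^-1 *: w).
  rewrite scaler_eq0 invr_eq0 negb_or d0 /=; apply: contra K0 => /eqP w0.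
  by rewrite -KE w0 -(scale0r (0 : 'rV[R]_4)) mx_of_pointZ scale0r.
by split; apply: mx_of_point_inj; rewrite scalerA mulrAC mulfV// mul1r
  mx_of_pointZ KE ?dyE ?dnuE rmorphD ?rmorphN rmorph1.
Qed.

Lemma is_curvature_of a b dy dnu : proportional a b dy dnu ->
  is_curvature dy dnu (curvature_of a b).
Proof.
move=> [ab [w w0 [-> ->]]]; rewrite /curvature_of; case: eqVneq => [b0|b0] /=.
  move: ab; rewrite b0 addr0 scale0r => a0; split=> //.
  by rewrite scaler_eq0 negb_or a0.
split; first by rewrite scaler_eq0 negb_or b0.
by rewrite opprK scalerA divfK.
Qed.

Lemma is_curvature_uniq a b dy dnu c : proportional a b dy dnu ->
  is_curvature dy dnu c -> c = curvature_of a b.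
Proof.
move=> /is_curvature_of; case: c (curvature_of a b) => [c|] [c'|] //=.
- move=> [dy0 ->] [_ /eqP]; rewrite -subr_eq0 -scalerBl scaler_eq0 (negPf dy0) orbF.
  by rewrite subr_eq0 eqr_opp => /eqP->.
- by move=> [-> _] [/eqP].
- by move=> [/eqP + _] [].
Qed.

Lemma opposite_signs_sym a b : opposite_signs a b <-> opposite_signs b a.
Proof. by rewrite /opposite_signs; tauto. Qed.

(** The two minus signs cancel, so the product is a a' / (b b'), which is negative exactly when
    numerator and denominator have opposite signs. *)
Lemma prod_neg_curvature_of a b a' b' :
  prod_neg (curvature_of a b) (curvature_of a' b') <->
  opposite_signs (a * a') (b * b').
Proof.
rewrite /curvature_of /opposite_signs.
(* With an infinite factor both sides are false: the product of denominators is 0 and has no strict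
   sign. *)
case: (eqVneq b 0) => [->|b0] /=; first by rewrite mul0r ltxx; split=> // -[[]|[]].
case: (eqVneq b' 0) => [->|b'0] /=; first by rewrite mulr0 ltxx; split=> // -[[]|[]].
rewrite /prod_neg mulrNN mulf_div.
have : b * b' != 0 by rewrite mulf_neq0.
move: (a * a') (b * b') => p q; rewrite neq_lt => /orP[q0|q0].
- rewrite q0 [0 < q]ltNge (ltW q0) nmulr_llt0 ?invr_lt0//=.
  by split=> [|[[]|[]]//]; left.
- rewrite q0 [q < 0]ltNge (ltW q0) pmulr_llt0 ?invr_gt0//=.
  by split=> [|[[]|[]]//]; right.
Qed.

Lemma prod_nonpos_neg_or_zero (c d : option R) :
  prod_nonpos c d <-> prod_neg c d \/ prod_zero c d.
Proof.
case: c d => [c|] [d|] /=; try tauto.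
rewrite /prod_nonpos /prod_neg /prod_zero.
rewrite le_eqVlt; split=> [/orP[/eqP|]|[->|->]].
- by right.
- by left.
- by rewrite orbT.
- by rewrite eqxx.
Qed.

End Curvature.

Lemma mulmx_conjB (K : comPzRingType) m (c : K) (P F W F' P' W' : 'M[K]_m) :
  c *: (P *m F *m W *m (F' *m P')) - P *m W' *m P' =
  P *m (c *: (F *m W *m F') - W') *m P'.
Proof. by rewrite mulmxBr mulmxBl -scalemxAr -scalemxAl !mulmxA. Qed.

(** * Curvatures of the surfaces given by the Weierstrass representation *)

Section Weierstrass.
Variable R : realType.
Variables (D : int -> set R) (g : int -> R -> R[i]) (tau : R -> R).
Variables (sigma : int -> R) (s lambda : R).
Variables (E : int -> R -> 'M[R[i]]_2) (x n : int -> R -> 'rV[R]_4).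
Hypothesis wr : weierstrass D g tau sigma s lambda E x n.
Implicit Types (k : int) (t : R) (e : R[i]).

Definition smooth_num k t : R :=
  sqn (cderive (g k) t) * (1 + s) - lambda * tau t * calT s (g k t) ^+ 2.
Definition smooth_den k t : R :=
  sqn (cderive (g k) t) * (1 - s) + lambda * tau t * calT s (g k t) ^+ 2.
Definition edge_num k t : R :=
  sqn (Delta g k t) * (1 + s) -
  lambda * sigma k * calT s (g k t) * calT s (g (k + 1) t).
Definition edge_den k t : R :=
  sqn (Delta g k t) * (1 - s) +
  lambda * sigma k * calT s (g k t) * calT s (g (k + 1) t).

(* With [e = 1] this describes [x], with [e = - 1] its normal [n]. *)
Definition framed e (y : int -> R -> 'rV[R]_4) : Prop := forall k t, D k t ->
  mx_of_point (y k t) =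
  (\det (E k t))^-1 *: (E k t *m Wmx e s (g k t) *m ctrmx (E k t)).

Lemma Lmx_frame k t e : D k t ->
  let EL := E k t *m Lmx s (g k t) in
  ((Num.sg (calT s (g k t)))%:C / \det (E k t)) *:
    (EL *m mx22 1 0 0 e *m ctrmx EL) =
  (\det (E k t))^-1 *: (E k t *m Wmx e s (g k t) *m ctrmx (E k t)).
Proof.
move=> Dkt /=; rewrite -(Lmx_Wmx e (wr_calT_neq0 wr Dkt)).
by rewrite mulrC ctrmxM -scalerA -scalemxAr -scalemxAl !mulmxA.
Qed.

Lemma framed_x : framed 1 x.
Proof.
move=> k t Dkt; have /= := Lmx_frame 1 Dkt; rewrite -mx22_1 mulmx1 => <-.
exact: (wr_x wr).
Qed.

Lemma framed_n : framed (- 1) n.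
Proof. by move=> k t Dkt; rewrite (wr_n wr Dkt) -Lmx_frame. Qed.

Lemma det_E_neq0 k t : D k t -> \det (E k t) != 0.
Proof. by move=> /(wr_E_unit wr); rewrite unitmxE unitfE. Qed.

Lemma frame_neq0 k t (M : 'M[R[i]]_2) : D k t -> M != 0 ->
  (\det (E k t))^-1 *: (E k t *m M *m ctrmx (E k t)) != 0.
Proof.
move=> Dkt; have Eu := wr_E_unit wr Dkt; apply: contra.
rewrite scaler_eq0 invr_eq0 (negPf (det_E_neq0 Dkt)) /= => /eqP EME.
rewrite -[M](mulKmx Eu) -[E k t *m M](mulmxK (ctrmx_unit Eu)) EME.
by rewrite mul0mx mulmx0.
Qed.

(** The next frame is [E *m F], so the increment of [y] is a conjugate by [E] of the increment in
    [Wmx_edge]. The matrix multiplied by the scalar does not depend on [e], which makes the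
    increments of [x] and [n] parallel. *)
Lemma framed_Delta e y k t : framed e y -> D k t -> D (k + 1) t ->
  mx_of_point (Delta y k t) =
  (1 + e * (lambda * sigma k * calT s (g k t) * calT s (g (k + 1) t) /
            sqn (Delta g k t) - s)%:C) *:
  ((\det (E k t))^-1 *: (E k t *m
     edge_dir s (g k t) (g (k + 1) t) (lambda * sigma k)%:C *m ctrmx (E k t))).
Proof.
move=> fy Dk Dk1; rewrite mx_of_pointB !fy//.
have m0 := wr_regular wr Dk Dk1.
have p0 := sdh_Delta_neq0 (wr_holomorphic wr) Dk Dk1.
have T0 := wr_calT_neq0 wr Dk; have T10 := wr_calT_neq0 wr Dk1.
have := Wmx_edge e T0 T10 p0 m0 => /=.
set F := 1%:M + _ => WF.
have E1 : E (k + 1) t = E k t *m F.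
  rewrite /F mulmxDr mulmx1 -[conn_mx _ _](wr_E_Delta wr Dk Dk1)
    mulKVmx ?(wr_E_unit wr)//.
  by rewrite [RHS]addrC subrK.
(* This turns the inverse determinant of the next frame into the factor [(1 - m)^-1] of
   [Wmx_edge]. *)
have detF : \det F = 1 - (lambda * sigma k)%:C.
  rewrite /F mx22_1 mx22_add det_mx22 !mxE /=; field.
  exact: p0.
rewrite E1 det_mulmx detF invfM -scalerA ctrmxM -scalerBr.
by rewrite mulmx_conjB WF -scalemxAr -scalemxAl !scalerA [X in X *: _]mulrC.
Qed.

Lemma framed_derive e y k t : framed e y -> D k t ->
  derivable (y k) t 1 /\ mx_of_point ('D_1 (y k) t) =
  (1 + e * (lambda * tau t * calT s (g k t) ^+ 2 / sqn (cderive (g k) t) - s)%:C) *: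
  ((\det (E k t))^-1 *:
    (E k t *m smooth_dir s (g k t) (cderive (g k) t) *m ctrmx (E k t))).
Proof.
move=> fy Dkt; apply: is_mxderive_mx_of_point.
have gh := wr_holomorphic wr.
have T0 := wr_calT_neq0 wr Dkt; have p0 := sdh_deriv_neq0 gh Dkt.
have dg := cderivableP (sdh_derivable gh Dkt).
pose V := conn_mx (cderive (g k) t) (lambda * tau t)%:C.
have dE : is_mxderive (E k) t (E k t *m V).
  have <- : invmx (E k t) *m mx_cderive (E k) t = V := wr_E_deriv wr Dkt.
  rewrite mulKVmx ?(wr_E_unit wr)//.
  exact/mx_cderivableP/(wr_E_derivable wr Dkt).
(* The connection matrix has zero diagonal, so Jacobi's formula removes the determinant factor from
   the product rule. *)
have ddet : is_cderive (fun u => \det (E k u)) t 0.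
  have := is_cderive_det dE; congr is_cderive.
  by rewrite /mxtrace !big_ord_recl big_ord0 !mxE /= !addr0 mul0r.
have dVdet := @is_cderiveV _ (fun u => \det (E k u)) t _ (det_E_neq0 Dkt) ddet.
have dW := is_mxderive_Wmx e T0 dg.
have dEW := is_mxderiveM (is_mxderiveM dE dW) (is_mxderive_ctrmx dE).
(* The frame formula for [y] is known on the domain only; openness of the slice makes it valid near
   [t], which suffices for the derivative. *)
apply: (@near_eq_is_mxderive _ _ _ (fun u => (\det (E k u))^-1 *:
    (E k u *m Wmx e s (g k u) *m ctrmx (E k u)))).
  have Dnear : \forall u \near t, D k u.
    by apply: open_nbhs_nbhs; split=> //; exact: (wr_open wr).
  by apply: filterS Dnear => u Dku; rewrite fy.
have := is_mxderiveZ dVdet dEW; congr is_mxderive.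
rewrite oppr0 mul0r scale0r add0r [RHS]scalerA mulrC -scalerA; congr (_ *: _).
rewrite scalemxAl scalemxAr -(Wmx_smooth e _ T0 p0) ctrmxM.
by rewrite !mulmxDr !mulmxDl !mulmxA.
Qed.

Lemma smooth_proportional k t : D k t ->
  proportional (smooth_num k t) (smooth_den k t) ('D_1 (x k) t) ('D_1 (n k) t).
Proof.
move=> Dkt; have [_ dx] := framed_derive framed_x Dkt.
have [_ dn] := framed_derive framed_n Dkt.
have p0 := sdh_deriv_neq0 (wr_holomorphic wr) Dkt.
have d0 : sqn (cderive (g k) t) != 0 by rewrite gt_eqF// sqn_gt0.
have := proportionalW d0 (frame_neq0 Dkt
  (smooth_dir_neq0 (wr_calT_neq0 wr Dkt) p0)) dx dn.
by congr proportional; rewrite /smooth_num /smooth_den; field.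
Qed.

Lemma edge_proportional k t : D k t -> D (k + 1) t ->
  proportional (edge_num k t) (edge_den k t) (Delta x k t) (Delta n k t).
Proof.
move=> Dk Dk1; have p0 := sdh_Delta_neq0 (wr_holomorphic wr) Dk Dk1.
have d0 : sqn (Delta g k t) != 0 by rewrite gt_eqF// sqn_gt0.
have := proportionalW d0 (frame_neq0 Dk
  (edge_dir_neq0 (wr_calT_neq0 wr Dk1) p0 (wr_regular wr Dk Dk1)))
  (framed_Delta framed_x Dk Dk1) (framed_Delta framed_n Dk Dk1).
by congr proportional; rewrite /edge_num /edge_den; field.
Qed.

Lemma principal_curvatures_x : principal_curvatures D x n
  (fun k t => curvature_of (smooth_num k t) (smooth_den k t))
  (fun k t => curvature_of (edge_num k t) (edge_den k t)).
Proof.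
split=> k t Dkt.
- exact: (framed_derive framed_x Dkt).1.
- exact: (framed_derive framed_n Dkt).1.
- exact/is_curvature_of/smooth_proportional.
- by move=> Dk1; exact/is_curvature_of/edge_proportional.
Qed.

Lemma principal_curvatures_n : principal_curvatures D n x
  (fun k t => curvature_of (smooth_den k t) (smooth_num k t))
  (fun k t => curvature_of (edge_den k t) (edge_num k t)).
Proof.
split=> k t Dkt.
- exact: (framed_derive framed_n Dkt).1.
- exact: (framed_derive framed_x Dkt).1.
- exact/is_curvature_of/proportional_sym/smooth_proportional.
- by move=> Dk1; exact/is_curvature_of/proportional_sym/edge_proportional.
Qed.

Lemma cond_smoothE k t : cond_smooth g tau s lambda k t <->
  opposite_signs (smooth_num k t * smooth_num (k + 1) t)
                 (smooth_den k t * smooth_den (k + 1) t).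
Proof. by []. Qed.

Lemma cond_discreteE k t : cond_discrete g sigma s lambda k t <->
  opposite_signs (edge_num (k - 1) t * edge_num k t)
                 (edge_den (k - 1) t * edge_den k t).
(* The edge starting at [k - 1] ends at [k - 1 + 1], which has to be read as [k]. *)
Proof. by rewrite /edge_num /edge_den /Delta subrK. Qed.

End Weierstrass.
Theorem theorem5p2 (R : realType) (D : int -> set R) (g : int -> R -> R[i])
    (tau : R -> R) (sigma : int -> R) (s lambda : R)
    (E : int -> R -> 'M[R[i]]_2) (x n : int -> R -> 'rV[R]_4)
    (xn_weierstrass : weierstrass D g tau sigma s lambda E x n) :
  (exists kx kx01 kn kn01 : int -> R -> option R,
    principal_curvatures D x n kx kx01 /\ principal_curvatures D n x kn kn01) /\
  forall kx kx01 kn kn01 : int -> R -> option R,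
  principal_curvatures D x n kx kx01 ->
  principal_curvatures D n x kn kn01 ->
  (* (i) discrete direction *)
  (forall (k : int) (t : R), D (k - 1) t -> D k t -> D (k + 1) t ->
    let C := cond_discrete g sigma s lambda k t in
    [/\ (prod_neg (kx01 (k - 1) t) (kx01 k t) <-> C) /\
        (prod_neg (kn01 (k - 1) t) (kn01 k t) <-> C),
        (prod_nonpos (kx01 (k - 1) t) (kx01 k t) <->
           C \/ prod_zero (kx01 (k - 1) t) (kx01 k t)) /\
        (prod_nonpos (kn01 (k - 1) t) (kn01 k t) <->
           C \/ prod_zero (kn01 (k - 1) t) (kn01 k t)) &
        (FPS_discrete kx01 k t <->
           C \/ (kx01 (k - 1) t = None \/ kx01 k t = None)) /\
        (FPS_discrete kn01 k t <->
           C \/ (kn01 (k - 1) t = None \/ kn01 k t = None))]) /\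
  (* (ii) smooth direction *)
  (forall (k : int) (t : R), D k t -> D (k + 1) t ->
    let C := cond_smooth g tau s lambda k t in
    [/\ (prod_neg (kx k t) (kx (k + 1) t) <-> C) /\
        (prod_neg (kn k t) (kn (k + 1) t) <-> C) &
        (prod_nonpos (kx k t) (kx (k + 1) t) <->
           C \/ prod_zero (kx k t) (kx (k + 1) t)) /\
        (prod_nonpos (kn k t) (kn (k + 1) t) <->
           C \/ prod_zero (kn k t) (kn (k + 1) t))]) /\
  (forall (k : int) (t : R), D (k - 1) t -> D k t -> D (k + 1) t ->
    let C := cond_smooth g tau s lambda (k - 1) t \/
             cond_smooth g tau s lambda k t in
    (FPS_smooth kx k t <->
       C \/ [\/ kx (k - 1) t = None, kx k t = None | kx (k + 1) t = None]) /\
    (FPS_smooth kn k t <->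
       C \/ [\/ kn (k - 1) t = None, kn k t = None | kn (k + 1) t = None])).

Proof.
have smx := smooth_proportional xn_weierstrass.
have edx := edge_proportional xn_weierstrass.
split.
  (* The explicit ratios serve as witnesses for the existence of curvatures. *)
  by do 4 eexists; split;
    [exact: principal_curvatures_x xn_weierstrass
    |exact: principal_curvatures_n xn_weierstrass].
move=> kx kx01 kn kn01 [_ _ kxP kx01P] [_ _ knP kn01P].
(* Uniqueness forces any given curvatures to equal the explicit ratios on the domain, so signs can
   be read off there. *)
have kxE k t : D k t -> kx k t = _ := fun Dkt =>
  is_curvature_uniq (smx k t Dkt) (kxP k t Dkt).
have knE k t : D k t -> kn k t = _ := fun Dkt =>
  is_curvature_uniq (proportional_sym (smx k t Dkt)) (knP k t Dkt).
have kx01E k t : D k t -> D (k + 1) t -> kx01 k t = _ := fun Dk Dk1 =>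
  is_curvature_uniq (edx k t Dk Dk1) (kx01P k t Dk Dk1).
have kn01E k t : D k t -> D (k + 1) t -> kn01 k t = _ := fun Dk Dk1 =>
  is_curvature_uniq (proportional_sym (edx k t Dk Dk1)) (kn01P k t Dk Dk1).
have discrete k t : D (k - 1) t -> D k t -> D (k + 1) t ->
    (prod_neg (kx01 (k - 1) t) (kx01 k t) <-> cond_discrete g sigma s lambda k t) /\
    (prod_neg (kn01 (k - 1) t) (kn01 k t) <-> cond_discrete g sigma s lambda k t).
  move=> Dm D0 D1; have D0' : D (k - 1 + 1) t by rewrite subrK.
  rewrite kx01E// kn01E// kx01E// kn01E//.
  have condE := iff_sym (cond_discreteE g sigma s lambda k t).
  split; apply: iff_trans (prod_neg_curvature_of _ _ _ _) _ => //.
  (* For [n] numerator and denominator are exchanged, and the condition is symmetric under this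
     exchange. *)
  exact: iff_trans (opposite_signs_sym _ _) condE.
have smooth k t : D k t -> D (k + 1) t ->
    (prod_neg (kx k t) (kx (k + 1) t) <-> cond_smooth g tau s lambda k t) /\
    (prod_neg (kn k t) (kn (k + 1) t) <-> cond_smooth g tau s lambda k t).
  move=> D0 D1.
  rewrite kxE// knE// kxE// knE//.
  have condE := iff_sym (cond_smoothE g tau s lambda k t).
  split; apply: iff_trans (prod_neg_curvature_of _ _ _ _) _ => //.
  exact: iff_trans (opposite_signs_sym _ _) condE.
split; last split.
- move=> k t Dm D0 D1 C; have [] := discrete k t Dm D0 D1; rewrite -/C.
  have := prod_nonpos_neg_or_zero (kx01 (k - 1) t) (kx01 k t).
  have := prod_nonpos_neg_or_zero (kn01 (k - 1) t) (kn01 k t).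
  by clearbody C; rewrite /FPS_discrete; split; split; tauto.
- move=> k t D0 D1 C; have [] := smooth k t D0 D1; rewrite -/C.
  have := prod_nonpos_neg_or_zero (kx k t) (kx (k + 1) t).
  have := prod_nonpos_neg_or_zero (kn k t) (kn (k + 1) t).
  by clearbody C; split; split; tauto.
- move=> k t Dm D0 D1 C; have [xC0 nC0] := smooth k t D0 D1.
  have D0' : D (k - 1 + 1) t by rewrite subrK.
  (* The product of the curvatures at [k - 1] and [k] is the smooth case based at [k - 1]; hence two
     instances of the condition enter. *)
  have [] := smooth (k - 1) t Dm D0'; rewrite subrK => xCm nCm.
  by rewrite /FPS_smooth /C -xC0 -xCm; split; [|rewrite xC0 xCm -nC0 -nCm]; tauto.
Qed.
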